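(* Let $\delta > 0$ be an integer. Then the number of finite groups $G$, up to isomorphism, such that $\Delta(G) = \delta$ is finite.
   Context: For a finite group $G$, let $C(G)$ denote the set (poset under inclusion) of all cyclic subgroups of $G$, including the trivial subgroup, and define $\Delta(G) = |G| - |C(G)|$, the difference between the order of $G$ and the number of its cyclic subgroups. *)

(* Defs.v *)
From mathcomp Require Import all_boot all_order all_fingroup all_solvable all_algebra.

Set Implicit Arguments.
Unset Strict Implicit.
Unset Printing Implicit Defensive.

Import GRing.Theory Num.Theory.
Local Open Scope group_scope.

Definition cyclic_subgroups (gT : finGroupType) (G : {group gT})
    : {set {group gT}} :=
  [set H in subgroups G | cyclic H].

(* Integer-valued, so that the subtraction is not truncated. *)
Definition Delta (gT : finGroupType) (G : {group gT}) : int :=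
  (#|G|%:Z - #|cyclic_subgroups G|%:Z)%R.

(* There are exactly n isomorphism classes of finite groups satisfying P:
   the H i form a system of representatives. The ambient type of G is
   arbitrary, so G ranges over all finite groups. *)
Definition num_isog_classes
    (P : forall gT : finGroupType, {group gT} -> Prop) (n : nat) : Prop :=
  exists (rT : 'I_n -> finGroupType) (H : forall i, {group rT i}),
    [/\ forall i, P (rT i) (H i),
        forall i j, H i \isog H j -> i = j
      & forall (gT : finGroupType) (G : {group gT}),
          P gT G -> exists i, G \isog H i].

(* Main.v *)
Require Import Defs.
From mathcomp Require Import all_boot all_order all_fingroup all_solvable all_algebra.

Set Implicit Arguments.
Unset Strict Implicit.
Unset Printing Implicit Defensive.

(** A positive [Delta G] bounds the order of [G], and only finitely many groups
    up to isomorphism have a bounded order.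

    For the bound, let [S] be the set of elements of [G] of order at least 3.
    Sending an element to the cyclic subgroup that it generates maps [G] onto
    the cyclic subgroups, and an element [x] of [S] generates the same subgroup
    as [x^-1 != x]. So at least half of [S] is lost in passing from elements to
    cyclic subgroups, that is, [#|S| <= 2 * Delta G]
    ([card_order_gt2_le_Delta]). The set [S] is nonempty when [Delta G] is
    positive, as otherwise that map is a bijection ([exists_order_gt2]).

    Once [S] contains some [x], its size controls the order of [G]
    ([card_le_order_gt2]). The conjugacy class of [x] lies in [S], so the
    centralizer of [x] has index at most [#|S|]. Moreover, if [y] centralizes
    [x] then [y] or [y * x] is in [S], for [y ^+ 2 = 1] gives
    [(y * x) ^+ 2 = x ^+ 2 != 1]; so the centralizer has at most [2 * #|S|]
    elements. Altogether [#|G| <= 2 * #|S| ^ 2 <= 8 * Delta G ^ 2].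

    For the finiteness, Cayley's theorem puts every group of order at most [N]
    in isomorphism with an element of a single finite type, that of the
    permutation groups of degree at most [N]; a system of representatives is
    extracted from it ([num_isog_classes_bounded]). *)

Import GRing.Theory Num.Theory.
Local Open Scope group_scope.

Lemma cyclic_subgroups_imset (gT : finGroupType) (G : {group gT}) :
  cyclic_subgroups G = [set <[x]>%G | x in G].
Proof.
apply/setP=> H; rewrite !inE; apply/andP/imsetP=> [[sHG /cyclicP[x defH]]|].
  by exists x; [rewrite -cycle_subG -defH | apply/val_inj].
by case=> x Gx ->; rewrite /= cycle_subG cycle_cyclic.
Qed.

Definition order_gt2 (gT : finGroupType) (G : {group gT}) : {set gT} :=
  [set x in G | x ^+ 2 != 1].

(** Each of these subgroups is generated by at least two elements of
    [order_gt2 G], a generator and its inverse. *)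
Lemma card_cycles_order_gt2 (gT : finGroupType) (G : {group gT}) :
  #|[set <[x]>%G | x in order_gt2 G]| * 2 <= #|order_gt2 G|.
Proof.
rewrite -[leqRHS]sum1_card -sum_nat_const.
rewrite (partition_big_imset (fun x : gT => <[x]>%G)) /=.
apply: leq_sum => _ /imsetP[x Sx ->]; rewrite sum1_card.
have /[!inE]/andP[Gx x2N1] := Sx.
apply/card_gt1P; exists x, x^-1; split.
- by rewrite unfold_in /= Sx eqxx.
- rewrite unfold_in /= !inE groupV Gx expgVn invg_eq1 x2N1 /=.
  by apply/eqP/val_inj; rewrite /= cycleV.
- by apply: contraNneq x2N1 => xV; rewrite expgS expg1 {2}xV mulgV.
Qed.

(** The elements outside [order_gt2 G] contribute at most one cyclic subgroup
    each, those in it at most one for two elements. *)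
Lemma card_order_gt2_le_Delta (gT : finGroupType) (G : {group gT}) :
  (#|order_gt2 G|%:Z <= 2 * Delta G)%R.
Proof.
have := card_cycles_order_gt2 G; set S := order_gt2 G => leCS.
have sSG : S \subset G by apply/subsetP=> x /[!inE] /andP[].
have cardG := cardsID S G; rewrite (setIidPr sSG) in cardG.
have leC : #|cyclic_subgroups G|
    <= #|[set <[x]>%G | x in S]| + #|G :\: S|.
  rewrite cyclic_subgroups_imset -{1}(setID G S) (setIidPr sSG) imsetU.
  apply: leq_trans (leq_card_setU _ _) _.
  by rewrite leq_add2l leq_imset_card.
have : #|S| + 2 * #|cyclic_subgroups G| <= 2 * #|G|.
  rewrite -cardG !mulnDr [X in _ <= X + _]mul2n -addnn -addnA leq_add2l.
  have := leq_mul (leqnn 2) leC; rewrite mulnDr => /leq_trans; apply.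
  by rewrite leq_add2r mulnC.
rewrite /Delta mulrBr lerBrDr -lez_nat PoszD !PoszM; exact.
Qed.

(** If every square in [G] is trivial, then [<[x]>] consists of [1] and [x], so
    it determines [x] and there are as many cyclic subgroups as elements. *)
Lemma exists_order_gt2 (gT : finGroupType) (G : {group gT}) :
  (0 < Delta G)%R -> exists x, x \in order_gt2 G.
Proof.
rewrite subr_gt0 ltz_nat cyclic_subgroups_imset => ltCG.
case: (set_0Vmem (order_gt2 G)) => [S0|[x Sx]]; last by exists x.
have cycleE x : x \in G -> <[x]> = [set 1; x].
  move=> Gx; have /setP/(_ x) := S0; rewrite !inE Gx => /negbFE/eqP x2.
  have [->|xN1] := eqVneq x 1; first by rewrite cycle1 setUid.
  by rewrite cycle2g //; apply/prime_nt_dvdP; rewrite ?order_eq1 ?order_dvdn ?x2.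
rewrite card_in_imset ?ltnn // in ltCG => x y Gx Gy [/setP eqxy].
have := eqxy x; have := eqxy y; rewrite !cycleE // !inE !eqxx !orbT.
by move=> /orP[/eqP->|/eqP//] /esym/orP[/eqP|/eqP].
Qed.

(** The class of [x] has at most [#|order_gt2 G|] elements and its centralizer
    at most twice as many. *)
Lemma card_le_order_gt2 (gT : finGroupType) (G : {group gT}) (x : gT) :
  x \in order_gt2 G -> #|G| <= 2 * #|order_gt2 G| ^ 2.
Proof.
set S := order_gt2 G => /[dup] Sx /[!inE]/andP[Gx x2N1].
have le_cent : #|'C_G[x]| <= #|S| + #|S|.
  rewrite -(cardsID S 'C_G[x]) leq_add //.
    by rewrite subset_leq_card ?subsetIr.
  (* Right translation by x sends the rest of the centralizer into S. *)
  rewrite -(card_rcoset _ x) subset_leq_card //.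
  apply/subsetP=> _ /rcosetP[y /setDP[/setIP[Gy /cent1P cxy] NSy] ->].
  rewrite !inE Gy /= negbK in NSy.
  by rewrite !inE groupM //= expgMn // (eqP NSy) mul1g.
have le_class : #|x ^: G| <= #|S|.
  apply/subset_leq_card/subsetP=> _ /imsetP[y Gy ->].
  by rewrite !inE groupJ //= -conjXg conjg_eq1.
rewrite -(Lagrange (subcent1_sub x G)) index_cent1.
by rewrite -mulnn mulnA leq_mul // mul2n -addnn.
Qed.

Lemma card_le_Delta (gT : finGroupType) (G : {group gT}) :
  (0 < Delta G)%R -> #|G| <= 8 * `|Delta G| ^ 2.
Proof.
move=> D_gt0; have [x Sx] := exists_order_gt2 D_gt0.
apply: leq_trans (card_le_order_gt2 Sx) _.
have leS : #|order_gt2 G| <= 2 * `|Delta G|.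
  have := card_order_gt2_le_Delta G.
  by rewrite -{1}(gtz0_abs D_gt0) -PoszM lez_nat.
by rewrite -[8]/(2 * 2 ^ 2)%N -mulnA -expnMn leq_mul2l leq_exp2r.
Qed.

Lemma isog_Delta (gT rT : finGroupType) (G : {group gT}) (H : {group rT}) :
  G \isog H -> Delta G = Delta H.
Proof.
have leC (aT bT : finGroupType) (A : {group aT}) (B : {group bT}) :
  A \isog B -> #|cyclic_subgroups A| <= #|cyclic_subgroups B|.
- case/isogP=> f injf fA.
  have injF : {in cyclic_subgroups A &, injective (fun K => f @* K)%G}.
    move=> K L /[!inE]/andP[sKA _] /andP[sLA _] /(congr1 val)/= eqf.
    by apply/val_inj/(injm_morphim_inj injf).
  rewrite -(card_in_imset injF) subset_leq_card //.
  apply/subsetP=> _ /imsetP[K /[!inE]/andP[sKA cycK] ->].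
  by rewrite /= -{1}fA morphimS // morphim_cyclic.
move=> isoGH; rewrite /Delta (card_isog isoGH); congr (_ - Posz _)%R.
by apply/eqP; rewrite eqn_leq !leC // isog_sym.
Qed.

Definition regular_rank (gT : finGroupType) (G : {group gT}) (x : gT)
    (i : 'I_#|G|) : 'I_#|G| :=
  enum_rank_in (group1 G) (enum_val i * x).

Lemma regular_rankK (gT : finGroupType) (G : {group gT}) (x : gT) :
  x \in G -> cancel (@regular_rank gT G x) (@regular_rank gT G x^-1).
Proof.
move=> Gx i; rewrite /regular_rank enum_rankK_in ?groupM ?enum_valP //.
by rewrite mulgK enum_valK_in.
Qed.

(** Cayley's theorem, with the regular action carried by the ranks of the
    elements rather than by the elements themselves: the target then depends
    on the order of the group only, not on its ambient type. *)
Lemma isog_ord_perm (gT : finGroupType) (G : {group gT}) :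
  exists H : {group 'S_#|G|}, G \isog H.
Proof.
(* A morphism needs a function on all of gT, but translation permutes G only
   for elements of G, hence the default value outside G. *)
pose f x : 'S_#|G| :=
  if insub x is Some u
  then perm (can_inj (regular_rankK (valP (u : {x | x \in G})))) else 1.
have fE x i : x \in G -> f x i = regular_rank x i.
  by move=> Gx; rewrite /f insubT permE.
have fM : {in G &, {morph f : x y / x * y}}.
  move=> x y Gx Gy; apply/permP=> i; rewrite permM !fE ?groupM //.
  by rewrite /regular_rank enum_rankK_in ?mulgA // groupM ?enum_valP.
pose F := Morphism fM.
exists (F @* G)%G; apply: sub_isog => //; apply/injmP=> x y Gx Gy /permP eqf.
have := eqf (enum_rank_in (group1 G) 1); rewrite /= !fE //.
rewrite /regular_rank enum_rankK_in // !mul1g.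
by move/(can_in_inj (enum_rankK_in _)); apply.
Qed.

(** By [isog_ord_perm], all the isomorphism classes meet the finite type of
    permutation groups of degree at most [N]. The boolean [p] makes it possible
    to collect those that satisfy [P] into a finite set, and invariance of [P]
    ensures that [P] passes to them and to their representatives. *)
Lemma num_isog_classes_bounded (P : forall gT : finGroupType, {group gT} -> Prop)
    (p : forall gT : finGroupType, pred {group gT}) (N : nat) :
    (forall gT (G : {group gT}), reflect (P gT G) (p gT G)) ->
    (forall (gT rT : finGroupType) (G : {group gT}) (H : {group rT}),
       G \isog H -> P gT G -> P rT H) ->
    (forall gT (G : {group gT}), P gT G -> #|G| <= N) ->
  exists n, num_isog_classes P n.
Proof.
move=> pP isoP leN.
pose T := {i : 'I_N.+1 & {group 'S_i}}.
pose iso (t u : T) := tagged t \isog tagged u.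
(* The choice made by pick depends only on the extension of its predicate, so
   isomorphic groups get the same representative. *)
pose rep (t : T) := odflt t [pick u | iso t u].
have isoxx t : iso t t by exact: isog_refl.
have iso_rep t : iso t (rep t).
  by rewrite /rep; case: pickP => // /(_ t); rewrite isoxx.
have rep_eq t u : iso t u -> rep t = rep u.
  move=> tu; rewrite /rep (_ : [pick v | iso t v] = [pick v | iso u v]).
    by case: pickP => // /(_ u); rewrite isoxx.
  by apply: eq_pick => v; apply: isog_transl.
pose A := [set rep t | t in [pred t : T | p _ (tagged t)]].
pose h (i : 'I_#|A|) : T := enum_val i.
have hA i : h i \in A by exact: enum_valP.
exists #|A|, (fun i => 'S_(tag (h i))), (fun i => tagged (h i)).
split=> [i|i j|gT G PG].
- have /imsetP[t /pP Pt ->] := hA i.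
  exact: isoP (iso_rep t) Pt.
- have /imsetP[t _ Et] := hA i; have /imsetP[u _ Eu] := hA j.
  move=> iso_ij; apply: enum_val_inj; rewrite -!/(h _) Et Eu; apply: rep_eq.
  apply: isog_trans (iso_rep t) _; rewrite -Et.
  by apply: isog_trans iso_ij _; rewrite Eu isog_sym; apply: iso_rep.
have [H isoGH] := isog_ord_perm G.
have ltGN : #|G| < N.+1 by rewrite ltnS leN.
pose t : T := Tagged (fun i : 'I_N.+1 => {group 'S_i}) (H : {group 'S_(Ordinal ltGN)}).
have At : rep t \in A by apply/imset_f/pP/(isoP _ _ _ _ isoGH).
exists (enum_rank_in At (rep t)); rewrite /h enum_rankK_in //.
exact: isog_trans isoGH (iso_rep t).
Qed.

Theorem corollary1 (delta : int) (delta_gt0 : (0 < delta)%R) :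
  exists n : nat,
    num_isog_classes
      (fun (gT : finGroupType) (G : {group gT}) => Delta G = delta) n.
Proof.
apply: (@num_isog_classes_bounded _
  (fun gT (G : {group gT}) => Delta G == delta) (8 * `|delta| ^ 2)).
- by move=> gT G; apply: eqP.
- by move=> gT rT G H /isog_Delta <-.
- by move=> gT G DG; rewrite -DG card_le_Delta ?DG.
Qed.
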